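(* Let $\{\xi_n\}_{n\ge1}$ be a sequence of i.i.d. random variables whose common distribution satisfies $\mathbb{E}|\xi_1|<\infty$ and $$\lim_{u\rightarrow\infty}u^{-p}\log\mathbb{P}\left\{|\xi_1|\geq u\right\}=-c$$ for some constants $p\geq1$ and $0<c<\infty$. Let $q$ be given by $\frac{1}{p}+\frac{1}{q}=1$, and suppose that two sequences of positive real numbers $\{a_n\}_{n\ge1}$ and $\{b_n\}_{n\ge1}$ satisfy $\sum_{n=1}^{\infty}a_n^{2\wedge q}<\infty$ and $\sum_{n=1}^{\infty}b_n^{2\wedge q}<\infty$. Then, as $r\rightarrow\infty$, $$\frac{\log\mathbb{P}\left\{\sum_{n=1}^{\infty}a_n|\xi_n|\geq r\right\}}{\log\mathbb{P}\left\{\sum_{n=1}^{\infty}b_n|\xi_n|\geq r\right\}}\sim\left(\frac{\|b\|_q}{\|a\|_q}\right)^p$$ and $$\frac{\log\mathbb{P}\left\{\sum_{n=1}^{\infty}a_n|\xi_n|\geq r\|a\|_q\right\}}{\log\mathbb{P}\left\{\sum_{n=1}^{\infty}b_n|\xi_n|\geq r\|b\|_q\right\}}\sim1.$$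
   Context: Here $2\wedge q=\min\{2,q\}$, and $q=\infty$ when $p=1$. For a real sequence $a=\{a_n\}$, $\|a\|_q=\left(\sum_{n=1}^{\infty}a_n^q\right)^{1/q}$ for finite $q$, and $\|a\|_\infty=\max_n|a_n|$. The notation $F(r)\sim G(r)$ as $r\to\infty$ means $F(r)/G(r)\to1$ as $r\to\infty$.
   Formalization: The formal theorem also assumes that Σ aₙ|ξₙ| and Σ bₙ|ξₙ| converge almost surely; without this the claim fails, e.g. p=1, ξ exponential, aₙ=1/n, bₙ=2^{-n}, where the first sum is infinite a.s. and the ratio is 0. *)

(* Defs.v *)
From HB Require Import structures.
From mathcomp Require Import all_boot all_order all_algebra finmap.
From mathcomp Require Import all_classical all_reals all_analysis.
From mathcomp Require Import ess_sup_inf.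

Set Implicit Arguments.
Unset Strict Implicit.
Unset Printing Implicit Defensive.

Import Order.TTheory GRing.Theory Num.Theory.
Import numFieldNormedType.Exports.

Local Open Scope classical_set_scope.
Local Open Scope ring_scope.

Section Probability.
Context {d : measure_display} {T : measurableType d} {R : realType}
        (P : probability T R).

Definition independent_seq (X : nat -> {RV P >-> R}) : Prop :=
  forall (J : {fset nat}) (B : nat -> set R),
    (forall i, measurable (B i)) ->
    P (\bigcap_(i in [set` J]) (X i @^-1` B i)) =
    (\prod_(i <- J) P (X i @^-1` B i))%E.

Definition identically_distributed (X : nat -> {RV P >-> R}) : Prop :=
  forall (n : nat) (B : set R), measurable B ->
    distribution P (X n) B = distribution P (X 0) B.

Definition iid (X : nat -> {RV P >-> R}) : Prop :=
  independent_seq X /\ identically_distributed X.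

(* [ln 0 = 0] here, whereas log P(A) would be -oo for a null event.  Under a
   tail hypothesis u^-p log P(|xi| >= u) --> - c with c > 0 no such event occurs:
   P(|xi| >= u) = 0 for one u would make the left-hand side eventually 0, and
   P(sum_n a_n |xi_n| >= r) >= P(a_0 |xi_0| >= r) > 0 when a_0 > 0. *)
Definition logP (A : set T) : R := ln (fine (P A)).

(* Extended-real valued; every term is nonnegative, so it always exists.
   Summability of a^(min 2 q) does not make it finite: for p = 1 (q = oo) and
   a_n = 1/(n+1) it is +oo almost surely, so that its log-tail is identically 0
   and the ratio of log-tails is meaningless.  Almost sure convergence of the
   series is therefore a separate, explicit condition, [as_convergent]. *)
Definition weighted_sum (a : nat -> R) (X : nat -> {RV P >-> R}) (w : T)
    : \bar R :=
  (\sum_(0 <= n <oo) (a n * `|X n w|)%:E)%E.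

Definition as_convergent (a : nat -> R) (X : nat -> {RV P >-> R}) : Prop :=
  {ae P, forall w, (weighted_sum a X w < +oo)%E}.

Definition log_tail (a : nat -> R) (X : nat -> {RV P >-> R}) (r : R) : R :=
  logP [set w | (r%:E <= weighted_sum a X w)%E].

End Probability.

Section Sequences.
Context {R : realType}.

Definition summable_pow (a : nat -> R) (e : R) : Prop :=
  (\sum_(0 <= n <oo) (a n `^ e)%:E < +oo)%E.

Definition two_min (q : \bar R) : R := fine (Order.min 2%:E q).

(* The l^q norm is the L^q norm for the counting measure on nat; see
   [lq_norm_fin] and [lq_norm_inf] for the usual formulas. *)
Definition lq_norm (q : \bar R) (a : nat -> R) : R :=
  fine ('N[@counting nat R]_q [EFin \o a])%E.

Lemma lq_norm_fin (q : R) (a : nat -> R) : 0 < q ->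
  lq_norm q%:E a =
  fine ((\sum_(0 <= n <oo) (`|a n| `^ q)%:E) `^ q^-1)%E.
Proof. by move=> q0; rewrite /lq_norm Lnorm_counting. Qed.

Lemma counting_setT_gt0 : (0 < @counting nat R [set: nat])%E = true.
Proof. by rewrite /counting asboolF ?ltry//; apply: infinite_nat. Qed.

Lemma lq_norm_inf (a : nat -> R) :
  lq_norm +oo%E a = fine (ereal_sup (range (fun n => `|a n|%:E))).
Proof.
rewrite /lq_norm unlock /Lnorm counting_setT_gt0; congr fine.
apply/eqP; rewrite eq_le; apply/andP; split.
  by apply/ess_supP; apply: nearW => n; apply: ereal_sup_ubound; exists n.
apply: ge_ereal_sup => _ [n _ <-].
have [N [mN N0 subN]] := ess_sup_ge (@counting nat R) (abse \o (EFin \o a)).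
apply: contrapT => nle; have /subN Nn : ~ (`|a n|%:E <=
  ess_sup (@counting nat R) (abse \o (EFin \o a)))%E by exact: nle.
have : (@counting nat R [set n] <= @counting nat R N)%E.
  by apply: le_measure; rewrite ?inE// => _ ->.
by rewrite [leRHS]N0 /counting asboolT// fset_set1 cardfs1 lee_fin ler10.
Qed.

Definition asymp_equiv (F G : R -> R) : Prop :=
  F r / G r @[r --> +oo] --> (1 : R).

End Sequences.

(* Main.v *)
Require Import Defs.
From HB Require Import structures.
From mathcomp Require Import all_boot all_order all_algebra finmap.
From mathcomp Require Import all_classical all_reals all_analysis.
From mathcomp Require Import measurable_realfun ring lra.

(** Write [S] for the sum of the [a n * |xi n|], [S_N] for its partial sums,
    [A] for the l^q norm of [a], and [-c] for the limit of
    [u^-p * log P(|xi| >= u)].  Both claims follow from the single limit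

      [r^-p * log P(S >= r) --> - c * A^-p]   ([log_tail_asymptotics]),

    because [A] enters it only through the factor [A^-p]: dividing the limits
    for [a] and [b] gives [(B / A)^p], and replacing [r] by [r * A] or [r * B]
    makes the two limits equal.

    Lower bound.  If [x n >= 0] and [\sum_(n < N) a n * x n >= 1], then [S >= r]
    as soon as [|xi n| >= r * x n] for all [n < N]; by independence the
    probability of this is about [exp (- c * r^p * \sum_(n < N) (x n)^p)]
    ([weighted_sum_tail_ge]).  By duality of l^p and l^q the infimum of
    [\sum (x n)^p] under this constraint is [A^-p] ([dual_sequence_gt1] when
    [1 < p], [dual_sequence_1] when [p = 1]).

    Upper bound.  For [c' < c] the tail makes [M = E exp (c' |xi|^p)] finite
    ([exp_moment_finite]).  When [1 < p], the inequality
    [p x^(p-1) u <= u^p + (p-1) x^p] turns this into a bound on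
    [log E exp (t |xi|)] by its leading term of order [t^q] plus a constant
    times [t] ([mgf_powR_bound]).  The linear error is what makes the bound
    usable for infinitely many factors: the errors add up to a constant times
    [t * \sum a n].  The exponential Chebyshev inequality with [t] of order
    [r^(p-1)] then has main exponent exactly [- c' (r / A)^p] and an error of
    order [r^(p-1)], which is negligible against [r^p]
    ([weighted_sum_tail_le_gt1]).  When [p = 1], convexity of [exp] plays the
    same role with the single value [t = c' / A] ([weighted_sum_tail_le_1]).

    Both uses need [\sum a n < oo], which is stronger than summability of
    [a^(min 2 q)].  It comes from almost sure convergence: [E exp (- S_N)] is
    bounded below uniformly in [N], while independence bounds it above by
    [exp (- const * \sum_(n < N) a n)] ([as_convergent_summable]). *)

Set Implicit Arguments.
Unset Strict Implicit.
Unset Printing Implicit Defensive.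

Import Order.TTheory GRing.Theory Num.Theory.
Import numFieldNormedType.Exports.

Local Open Scope classical_set_scope.
Local Open Scope ring_scope.

(** * Expectations of products of independent random variables *)

Lemma lee_prod_ge0 {R : realDomainType} (I : Type) (r : seq I) (Q : pred I)
    (f g : I -> \bar R) : (forall i, Q i -> (0 <= f i <= g i)%E) ->
  (\prod_(i <- r | Q i) f i <= \prod_(i <- r | Q i) g i)%E.
Proof.
move=> fg.
suff /andP[] : (0 <= \prod_(i <- r | Q i) f i <= \prod_(i <- r | Q i) g i)%E by [].
elim/big_ind2 : _ => // [|u1 v1 u2 v2 /andP[u10 uv1] /andP[u20 uv2]].
  by rewrite lee01 lexx.
by rewrite mule_ge0// lee_pmul.
Qed.

Section IndependentProducts.
Context {d : measure_display} {T : measurableType d} {R : realType}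
        (P : probability T R).
Import HBNNSimple.

(** Both sides are additive and continuous along increasing sequences in [f],
    so the identity spreads from indicators to simple functions and then, by
    monotone convergence, to all nonnegative measurable functions.  It lets one
    factor of a product vary while the others stay fixed. *)
Lemma integral_mul_comp_of_indicators (X : {RV P >-> R}) (Z : T -> R) (k : \bar R) :
    measurable_fun setT Z -> (forall w, 0 <= Z w) -> k \is a fin_num ->
    (forall B, measurable B ->
       (\int[P]_w (Z w * \1_B (X w))%:E = k * P (X @^-1` B))%E) ->
  forall f : R -> R, measurable_fun setT f -> (forall x, 0 <= f x) ->
    (\int[P]_w (Z w * f (X w))%:E = k * \int[P]_w (f (X w))%:E)%E.
Proof.
move=> mZ Z0 kfin ZB f mf f0.
have mX : measurable_fun setT X by [].
have simple (h : {nnsfun R >-> R}) :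
    (\int[P]_w (Z w * h (X w))%:E = k * \int[P]_w (h (X w))%:E)%E.
  have mB y : measurable (h @^-1` [set y]) by exact: measurable_funPTI.
  have mI y : measurable_fun setT (fun w => \1_(h @^-1` [set y]) (X w) : R).
    by apply: measurableT_comp => //; exact: measurable_indic.
  have expand (V : T -> R) : measurable_fun setT V -> (forall w, 0 <= V w) ->
      (\int[P]_w (V w * h (X w))%:E = \sum_(y \in range h)
        y%:E * \int[P]_w (V w * \1_(h @^-1` [set y]) (X w))%:E)%E.
    move=> mV V0.
    under eq_integral => w _.
      rewrite fimfunE fsbig_finite//= big_distrr/= -sumEFin.
      under eq_bigr do rewrite mulrCA.
      over.
    rewrite ge0_integral_sum//; last 2 first.
    - move=> y; apply/measurable_EFinP; apply: measurable_funM => //.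
      exact: measurable_funM.
    - move=> y w _; have [hy|hy] := boolP (X w \in h @^-1` [set y]).
        by move/set_mem: hy => <-; rewrite lee_fin !mulr_ge0// fun_ge0.
      by rewrite indicE (negbTE hy) !mulr0.
    rewrite fsbig_finite//=; apply: eq_big_seq => y.
    rewrite in_fset_set// inE => -[x _ <-].
    under eq_integral do rewrite EFinM.
    rewrite ge0_integralZl_EFin// ?fun_ge0//.
    - by move=> w _; rewrite lee_fin mulr_ge0.
    - by apply/measurable_EFinP; exact: measurable_funM.
  rewrite (expand Z)//.
  under [in RHS]eq_integral do rewrite -(mul1r (h _)).
  rewrite (expand (fun=> 1))// !fsbig_finite//= big_seq [in RHS]big_seq.
  have rangeP y : y \in fset_set (range h) -> 0 <= y.
    by rewrite in_fset_set// inE => -[x _ <-]; rewrite fun_ge0.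
  rewrite ge0_sume_distrr => [|y /rangeP y0]; last first.
    by rewrite mule_ge0// integral_ge0// => w _; rewrite lee_fin mul1r indicE.
  apply: eq_bigr => y yh; rewrite ZB//.
  under [in RHS]eq_integral do rewrite mul1r.
  rewrite muleCA; congr (_ * (_ * _))%E.
  rewrite (_ : (fun w => _) = EFin \o \1_(X @^-1` (h @^-1` [set y])))//.
  by rewrite integral_indic ?setIT// -[X in measurable X]setTI; exact: mX.
pose g n := nnsfun_approx measurableT (measurableT_comp (@EFin_measurable R setT) mf) n.
have g_cvg x : (g n x)%:E @[n --> \oo] --> (f x)%:E.
  by apply: (cvg_nnsfun_approx measurableT) => // y _; rewrite lee_fin.
have g_nd x : nondecreasing_seq (fun n => (g n x)%:E).
  by move=> m n mn; rewrite lee_fin; apply/lefP/nd_nnsfun_approx.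
have mgX n : measurable_fun setT (fun w => g n (X w)) by exact: measurableT_comp.
have mono (V : T -> R) : measurable_fun setT V -> (forall w, 0 <= V w) ->
    (\int[P]_w (V w * g n (X w))%:E @[n --> \oo]
      --> \int[P]_w (V w * f (X w))%:E)%E.
  move=> mV V0.
  rewrite (_ : (\int[P]_w _)%E =
      (\int[P]_w limn (fun n => (V w * g n (X w))%:E))%E); last first.
    apply: eq_integral => w _; apply/esym/cvg_lim => //.
    under eq_fun do rewrite EFinM.
    by rewrite EFinM; apply: cvgeZl.
  apply: cvg_monotone_convergence => //.
  - by move=> n; apply/measurable_EFinP; exact: measurable_funM.
  - by move=> n w _; rewrite lee_fin mulr_ge0// fun_ge0.
  - by move=> w _ m n mn; rewrite lee_fin ler_wpM2l// -lee_fin g_nd.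
have /cvg_lim <- // := mono Z mZ Z0.
under eq_fun do rewrite simple.
apply/cvg_lim => //.
have := mono (fun=> 1) (measurable_cst _) (fun=> ler01).
under eq_fun do under eq_integral do rewrite mul1r.
under [in X in _ --> X]eq_integral do rewrite mul1r.
exact: cvgeZl.
Qed.

Lemma independent_bigcap (X : nat -> {RV P >-> R}) (B : nat -> set R) n :
    independent_seq X -> (forall i, measurable (B i)) ->
  (P (\bigcap_(i in `I_n) (X i @^-1` B i)) =
   \prod_(i < n) P (X i @^-1` B i))%E.
Proof.
move=> indX mB; pose J := [fset i | i in iota 0 n]%fset.
have memJ i : (i \in J) = (i < n)%N.
  by apply/imfsetP/idP => /= [[j]|ilt]; [|exists i => //]; rewrite mem_iota// => + ->.
have -> : `I_n = [set` J] by apply/seteqP; split => i /=; rewrite memJ.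
rewrite indX// -(big_mkord xpredT (fun i => P (X i @^-1` B i))) /index_iota subn0.
apply: perm_big; apply: uniq_perm => //; first exact: iota_uniq.
by move=> i; rewrite memJ mem_iota.
Qed.

Lemma independent_indicators (X : nat -> {RV P >-> R}) (B : nat -> set R) n :
    independent_seq X -> (forall i, measurable (B i)) ->
  (\int[P]_w (\prod_(i < n) \1_(B i) (X i w))%:E =
   \prod_(i < n) \int[P]_w (\1_(B i) (X i w))%:E)%E.
Proof.
move=> indX mB.
have mXB i : measurable (X i @^-1` B i) by exact: measurable_funPTI.
have intI i : (\int[P]_w (\1_(B i) (X i w))%:E = P (X i @^-1` B i))%E.
  rewrite (_ : (fun w => _) = EFin \o \1_(X i @^-1` B i))//.
  by rewrite integral_indic ?setIT.
under [RHS]eq_bigr do rewrite intI.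
rewrite -independent_bigcap//.
have mI : measurable (\bigcap_(i in `I_n) (X i @^-1` B i)).
  by apply: bigcap_measurableType => i _.
rewrite -[in RHS](setIT (bigcap _ _)) -integral_indic//.
apply: eq_integral => w _ /=; congr EFin.
rewrite [in RHS]indicE; case: (boolP (w \in _)) => [/set_mem|/negP] wI.
  by rewrite big1// => i _; rewrite indicE mem_set//; apply: wI => /=.
apply/eqP/prodf_eq0; apply: contrapT => nz; apply: wI; apply/mem_set => i /= ilt.
apply: contrapT => nB; apply: nz.
by exists (Ordinal ilt) => //=; rewrite indicE memNset.
Qed.

(** The indicators of independent events factorize by definition; the factors
    are then replaced one at a time by arbitrary functions. *)
Lemma expectation_prod (X : nat -> {RV P >-> R}) (f : nat -> R -> R) n :
    independent_seq X -> (forall i, measurable_fun setT (f i)) ->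
    (forall i x, 0 <= f i x) ->
    (forall i, (\int[P]_w (f i (X i w))%:E < +oo)%E) ->
  (\int[P]_w (\prod_(i < n) f i (X i w))%:E =
   \prod_(i < n) \int[P]_w (f i (X i w))%:E)%E.
Proof.
move=> indX.
(* [k] counts the factors that are no longer required to be indicators. *)
suff main k : (k <= n)%N -> forall f : nat -> R -> R,
    (forall i, measurable_fun setT (f i)) -> (forall i x, 0 <= f i x) ->
    (forall i, (\int[P]_w (f i (X i w))%:E < +oo)%E) ->
    (forall i, (k <= i)%N -> exists2 B, measurable B & f i = \1_B) ->
    (\int[P]_w (\prod_(i < n) f i (X i w))%:E =
     \prod_(i < n) \int[P]_w (f i (X i w))%:E)%E.
  move=> mf f0 foo.
  (* The factors of index at least [n] do not occur; they are made indicators. *)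
  pose g i := if (i < n)%N then f i else \1_setT.
  have gE (i : 'I_n) : g i = f i by rewrite /g ltn_ord.
  transitivity (\int[P]_w (\prod_(i < n) g i (X i w))%:E)%E.
    by apply: eq_integral => w _; congr EFin; apply: eq_bigr => i _; rewrite gE.
  rewrite (main n)//.
  - by apply: eq_bigr => i _; rewrite gE.
  - by move=> i; rewrite /g; case: ifP.
  - by move=> i x; rewrite /g; case: ifP => // _; rewrite indicE.
  - move=> i; rewrite /g; case: ifP => // _.
    have -> : (fun w => (\1_setT (X i w) : R)%:E) = cst 1%:E.
      by apply/funext => w; rewrite indicT.
    by rewrite integral_cst// mul1e (le_lt_trans (probability_le1 _ _)) ?ltry.
  - by move=> i; rewrite /g ltnNge => ->; exists setT.
elim: k => [_|k IH kn] {}f mf f0 foo fI.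
  pose B i := projT1 (cid2 (fI i (leq0n i))).
  have mB i : measurable (B i) by rewrite /B; case: cid2.
  have fB i : f i = \1_(B i) by rewrite {1}/B; case: cid2.
  under eq_integral do under eq_bigr do rewrite fB.
  by rewrite independent_indicators//; apply: eq_bigr => i _; rewrite fB.
pose o := Ordinal kn.
pose Z w := \prod_(i < n | i != o) f i (X i w).
pose E := (\prod_(i < n | i != o) \int[P]_w (f i (X i w))%:E)%E.
have E_fin : E \is a fin_num.
  rewrite /E; elim/big_rec : _ => // i x _ xfin; rewrite fin_numM// ge0_fin_numE//.
  by apply: integral_ge0 => w _; rewrite lee_fin.
have mfX i : measurable_fun setT (fun w => f i (X i w)) by exact: measurableT_comp.
rewrite (bigD1 o)//= muleC.
under eq_integral do rewrite (bigD1 o)//= mulrC.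
apply: (@integral_mul_comp_of_indicators (X k) Z) => //.
- rewrite /Z; under eq_fun do rewrite big_mkcond/=.
  apply: measurable_prod => i _; case: (i != o); [exact: mfX|exact: measurable_cst].
- by move=> w; rewrite /Z prodr_ge0.
move=> B mB; pose g i := if i == k then \1_B else f i : R -> R.
have gk : g k = \1_B by rewrite /g eqxx.
have gE (i : 'I_n) : i != o -> g i = f i.
  move=> io; rewrite /g; case: eqP => // ik; case/eqP: io; exact: val_inj.
have intB : (\int[P]_w (\1_B (X k w))%:E = P (X k @^-1` B))%E.
  rewrite (_ : (fun w => _) = EFin \o \1_(X k @^-1` B))//.
  by rewrite integral_indic ?setIT//; exact: measurable_funPTI.
have -> : (E * P (X k @^-1` B) = \prod_(i < n) \int[P]_w (g i (X i w))%:E)%E.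
  rewrite [RHS](bigD1 o)//= gk intB muleC; congr (_ * _)%E.
  by apply: eq_bigr => i io; rewrite gE.
rewrite -(IH (ltnW kn) g).
- apply: eq_integral => w _; congr EFin; rewrite [RHS](bigD1 o)//= gk mulrC.
  by congr (_ * _); apply: eq_bigr => i io; rewrite gE.
- by move=> i; rewrite /g; case: ifP.
- by move=> i x; rewrite /g; case: ifP => // _; rewrite indicE.
- move=> i; rewrite /g; case: ifP => // /eqP ->; rewrite intB.
  by rewrite (le_lt_trans (probability_le1 _ _)) ?ltry//; exact: measurable_funPTI.
- move=> i ki; rewrite /g; case: eqP => [_|/eqP ik]; first by exists B.
  by apply: fI; rewrite ltn_neqAle eq_sym ik.
Qed.

End IndependentProducts.

(** * Exponential moments *)

Section Moments.
Context {d : measure_display} {T : measurableType d} {R : realType}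
        (P : probability T R).

Lemma expectation_iid (X : nat -> {RV P >-> R}) (f : R -> R) n :
    identically_distributed X -> measurable_fun setT f -> (forall x, 0 <= f x) ->
  (\int[P]_w (f (X n w))%:E = \int[P]_w (f (X 0%N w))%:E)%E.
Proof.
move=> idX mf f0.
have dist m : (\int[P]_w (f (X m w))%:E = \int[distribution P (X m)]_y (f y)%:E)%E.
  rewrite ge0_integral_distribution//; first exact/measurable_EFinP.
rewrite !dist; apply: eq_measure_integral => A mA _; exact: idX.
Qed.

Lemma measurable_ge (Y : T -> R) v :
  measurable_fun setT Y -> measurable [set w | v <= Y w].
Proof.
move=> mY; rewrite (_ : [set _ | _] = Y @^-1` `[v, +oo[).
  by rewrite -[X in measurable X]setTI; exact: mY.
by apply/seteqP; split => w /=; rewrite in_itv/= andbT.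
Qed.

(** Cutting at integer values, [exp (c2 Y)] is at most the sum over [k] of
    [exp (c2 (k + 1))] times the indicator of [k <= Y], whose expectation is
    dominated by a geometric series of ratio [exp (c2 - c1)]. *)
Lemma exp_moment_finite (Y : T -> R) (C c1 c2 : R) :
    measurable_fun setT Y -> (forall w, 0 <= Y w) -> 0 <= c2 < c1 ->
    (forall v, 0 <= v ->
       (P [set w | (v <= Y w)%R] <= (C * expR (- (c1 * v)))%:E)%E) ->
  (\int[P]_w (expR (c2 * Y w))%:E < +oo)%E.
Proof.
move=> mY Y0 /andP[c20 c21] tail.
pose A k := [set w | k%:R <= Y w].
have mA k : measurable (A k) by exact: measurable_ge.
pose g k w := (expR (c2 * k.+1%:R) * \1_(A k) w)%:E.
have g0 k w : (0 <= g k w)%E by rewrite lee_fin mulr_ge0// ?expR_ge0// indicE.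
have mg k : measurable_fun setT (g k).
  by apply/measurable_EFinP; apply: measurable_funM => //; exact: measurable_indic.
apply: (@le_lt_trans _ _ (\int[P]_w \sum_(0 <= k <oo) g k w)%E).
  apply: ge0_le_integral => //.
  - apply/measurable_EFinP; apply: measurableT_comp => //.
    exact: measurable_funM.
  - exact: ge0_emeasurable_sum.
  move=> w _; pose k := Num.truncn (Y w).
  have /andP[kY Yk] := truncn_itv (Y0 w).
  apply: le_trans (nneseries_lim_ge k.+1 _); last by move=> *; exact: g0.
  rewrite big_nat_recr//= -[X in (X <= _)%E]add0e leeD ?sume_ge0//.
  rewrite lee_fin indicE mem_set// mulr1 ler_expR ler_wpM2l//; exact: ltW.
rewrite integral_nneseries//.
pose z := expR (c2 - c1); pose a := C * expR c2.
have z1 : z < 1 by rewrite expR_lt1 subr_lt0.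
apply: (@le_lt_trans _ _ (a / (1 - z))%:E); last exact: ltry.
apply: lime_le.
  by apply: is_cvg_nneseries => k _ _; apply: integral_ge0.
apply: nearW => n.
apply: (@le_trans _ _ (\sum_(0 <= k < n) (a * z ^+ k)%:E)%E).
  apply: lee_sum => k _.
  rewrite /g; under eq_integral do rewrite EFinM.
  rewrite ge0_integralZl_EFin ?expR_ge0//; last exact/measurable_EFinP.
  rewrite integral_indic// setIT.
  apply: (@le_trans _ _ ((expR (c2 * k.+1%:R))%:E * (C * expR (- (c1 * k%:R)))%:E)%E).
    by apply: lee_wpmul2l; [rewrite lee_fin expR_ge0|exact: tail].
  rewrite -EFinM lee_fin /a /z -expRM_natr mulrCA -!mulrA -!expRD.
  rewrite ler_wpM2l//; last by rewrite ler_expR -natr1; lra.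
  have := tail 0 (lexx _); rewrite mulr0 oppr0 expR0 mulr1.
  by rewrite -lee_fin; exact: le_trans.
rewrite sumEFin lee_fin.
have := @geometric_le_lim R n a z.
rewrite /series/= ger0_norm ?expR_ge0//; apply => //; last exact: expR_gt0.
apply: mulr_ge0; last exact: expR_ge0.
have := tail 0 (lexx _); rewrite mulr0 oppr0 expR0 mulr1.
by rewrite -lee_fin; exact: le_trans.
Qed.

(** By convexity [exp (s Y) <= 1 - s + s exp Y], and [1 + x <= exp x].  The
    exponent is linear in [s], hence summable when [s] is. *)
Lemma mgf_convex (Y : T -> R) (s M : R) :
    measurable_fun setT Y -> 0 <= s <= 1 ->
    (\int[P]_w (expR (Y w))%:E <= M%:E)%E ->
  (\int[P]_w (expR (s * Y w))%:E <= (expR (s * (M - 1)))%:E)%E.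
Proof.
move=> mY /andP[s0 s1] intY.
have mE (c : R) : measurable_fun setT (fun w => (expR (c * Y w))%:E).
  apply/measurable_EFinP; apply: measurableT_comp => //; exact: measurable_funM.
have mE1 : measurable_fun setT (fun w => (expR (Y w))%:E).
  by apply/measurable_EFinP; exact: measurableT_comp.
apply: (@le_trans _ _ (\int[P]_w ((1 - s)%:E + s%:E * (expR (Y w))%:E))%E).
  apply: ge0_le_integral => //.
  - by apply: emeasurable_funD => //; exact: measurable_funeM.
  move=> w _; rewrite -EFinM -EFinD lee_fin.
  have := convex_expR (Itv01 s0 s1) (Y w) 0.
  by rewrite expR0 !convRE/= mulr0 addr0 mulr1 addrC.
have mcE : measurable_fun setT (fun w => s%:E * (expR (Y w))%:E)%E.
  exact: measurable_funeM.
have cE0 w : setT w -> (0 <= s%:E * (expR (Y w))%:E)%E.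
  by move=> _; rewrite mule_ge0// lee_fin expR_ge0.
have c0 (w : T) : setT w -> (0 <= (1 - s)%:E)%E by rewrite lee_fin subr_ge0.
rewrite ge0_integralD//.
rewrite integral_cst// ge0_integralZl_EFin//.
have P1 : P setT = 1%E by exact: probability_setT.
rewrite [X in (_ * X + _)%E]P1 mule1.
apply: (@le_trans _ _ ((1 - s)%:E + s%:E * M%:E)%E).
  by rewrite leeD2l// lee_wpmul2l.
rewrite -EFinM -EFinD lee_fin (le_trans _ (expR_ge1Dx _))//.
by rewrite mulrBr mulr1; lra.
Qed.

End Moments.

Lemma powR_div {R : realType} (x y r : R) : 0 <= x -> 0 < y ->
  (x / y) `^ r = x `^ r / y `^ r.
Proof.
move=> x0 y0; rewrite powRM ?invr_ge0 ?(ltW y0)//; congr (_ * _).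
by rewrite -[in RHS]powRN -mulN1r powRrM powR_inv1// ltW.
Qed.

Lemma conjugate_exponentE {R : realType} (p q : R) : 1 < p ->
  p^-1 + q^-1 = 1 -> q = p / (p - 1).
Proof.
move=> p1 pq; have p0 : 0 < p by rewrite (lt_trans _ p1).
have : q^-1 = (p - 1) / p by rewrite mulrBl mul1r divff ?gt_eqF// -pq addrC addKr.
by move/(congr1 (fun x => x^-1)); rewrite invrK invf_div.
Qed.

(** The graph of [u^p] lies above its tangent at [x]. *)
Lemma tangent_powR {R : realType} (p u x : R) : 1 < p -> 0 <= u -> 0 <= x ->
  p * x `^ (p - 1) * u <= u `^ p + (p - 1) * x `^ p.
Proof.
move=> p1 u0 x0.
have p0 : 0 < p by rewrite (lt_trans _ p1).
have p10 : 0 < p - 1 by rewrite subr_gt0.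
pose q := p / (p - 1).
have q0 : 0 < q by rewrite divr_gt0.
have pq : p^-1 + q^-1 = 1 by rewrite /q; field; rewrite !gt_eqF.
have := conjugate_powR u0 (powR_ge0 x (p - 1)) p0 q0 pq.
rewrite -powRrM (_ : (p - 1) * q = p); last by rewrite /q; field; rewrite gt_eqF.
rewrite -(ler_pM2l p0) => /le_trans; rewrite -mulrA (mulrC _ u); apply.
rewrite le_eqVlt; apply/orP; left; apply/eqP; rewrite /q; field.
by rewrite !gt_eqF.
Qed.

Section Mgf.
Context {d : measure_display} {T : measurableType d} {R : realType}
        (P : probability T R).

Lemma measurable_expRM (Y : T -> R) (c : R) : measurable_fun setT Y ->
  measurable_fun setT (fun w => (expR (c * Y w))%:E).
Proof.
move=> mY; apply/measurable_EFinP; apply: measurableT_comp => //.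
exact: measurable_funM.
Qed.

Lemma le_exp_moment (Y Z : T -> R) (c : R) :
    measurable_fun setT Y -> measurable_fun setT Z ->
    (forall w, Y w <= Z w + c) ->
  (\int[P]_w (expR (Y w))%:E <= (expR c)%:E * \int[P]_w (expR (Z w))%:E)%E.
Proof.
move=> mY mZ YZ.
have mE (V : T -> R) : measurable_fun setT V ->
    measurable_fun setT (fun w => (expR (V w))%:E).
  by move=> mV; apply/measurable_EFinP; exact: measurableT_comp.
rewrite -ge0_integralZl_EFin ?expR_ge0//; last exact: mE.
apply: ge0_le_integral => //; [exact: mE|by apply: measurable_funeM; exact: mE|].
by move=> w _; rewrite -EFinM lee_fin -expRD ler_expR addrC.
Qed.

(** The Laplace transform at [t = c p x^(p-1)], parametrized by the point [x]
    where the tangent to [c u^p] has slope [t].  The tangent inequality gives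
    the main term with the factor [M] in front.  For [x >= 1] that factor is at
    most [exp (C x^(p-1))]; for [x < 1] convexity between [t = 0] and the value
    at [x = 1] removes it. *)
Lemma mgf_powR_bound (Y : T -> R) (p c M : R) :
    measurable_fun setT Y -> (forall w, 0 <= Y w) -> 1 < p -> 0 <= c ->
    (\int[P]_w (expR (c * Y w `^ p))%:E <= M%:E)%E ->
  exists2 C, 0 <= C & forall x, 0 <= x ->
    (\int[P]_w (expR (c * p * x `^ (p - 1) * Y w))%:E <=
     (expR (c * (p - 1) * x `^ p + C * x `^ (p - 1)))%:E)%E.
Proof.
move=> mY Y0 p1 c0 intM.
have p0 : 0 < p by rewrite (lt_trans _ p1).
have p10 : 0 < p - 1 by rewrite subr_gt0.
have mYp : measurable_fun setT (fun w => c * Y w `^ p).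
  by apply: measurable_funM => //; exact: measurableT_comp (measurable_powR _) mY.
have mlin a : measurable_fun setT (fun w => a * Y w) by exact: measurable_funM.
have M1 : 1 <= M.
  rewrite -lee_fin (le_trans _ intM)//.
  have P1 : P setT = 1%E by exact: probability_setT.
  rewrite -P1 -[X in (X <= _)%E]mul1e -(integral_cst _ measurableT).
  apply: ge0_le_integral => //.
    by apply/measurable_EFinP; exact: measurableT_comp.
  by move=> w _; rewrite lee_fin -expR0 ler_expR mulr_ge0 ?powR_ge0.
have young x : 0 <= x -> (\int[P]_w (expR (c * p * x `^ (p - 1) * Y w))%:E <=
     (expR (c * (p - 1) * x `^ p) * M)%:E)%E.
  move=> x0; rewrite EFinM.
  apply: le_trans (lee_wpmul2l _ intM); last by rewrite lee_fin expR_ge0.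
  apply: le_exp_moment => // w.
  have := tangent_powR p1 (Y0 w) x0 => /(ler_wpM2l c0).
  by rewrite mulrDr !mulrA.
pose C := M * expR (c * (p - 1)) - 1.
have MC : M - 1 <= C.
  rewrite lerB// ler_peMr//; first exact: le_trans M1.
  by rewrite -[leLHS]expR0 ler_expR mulr_ge0// ltW.
have C0 : 0 <= C by rewrite (le_trans _ MC)// subr_ge0.
exists C => // x x0; have [x1|x1] := leP 1 x.
  apply: le_trans (young _ x0) _; rewrite lee_fin expRD ler_wpM2l ?expR_ge0//.
  have /le_trans : M <= expR (M - 1) by rewrite (le_trans _ (expR_ge1Dx _))// addrC subrK.
  apply; rewrite ler_expR (le_trans MC)// ler_peMr//.
  by rewrite -[leLHS](powRr0 x) ler_powR// ltW.
have := young 1 ler01; rewrite !powR1 !mulr1 (mulrC (expR _)) => young1.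
have s01 : 0 <= x `^ (p - 1) <= 1.
  rewrite powR_ge0 /= (le_trans (ge0_ler_powR _ _ _ (ltW x1))) ?nnegrE ?powR1//.
  exact: ltW.
have := mgf_convex (mlin (c * p)) s01 young1.
under eq_integral do rewrite mulrCA mulrA.
move=> /le_trans; apply.
by rewrite lee_fin ler_expR (mulrC C) lerDr !mulr_ge0 ?powR_ge0// ltW.
Qed.

End Mgf.

(** * Exponential Chebyshev bounds for weighted sums *)

Section Chernoff.
Context {d : measure_display} {T : measurableType d} {R : realType}
        (P : probability T R).
Implicit Types (X : nat -> {RV P >-> R}) (a : nat -> R).

Lemma measurable_abs_RV X n : measurable_fun setT (fun w => `|X n w|).
Proof. exact: measurableT_comp. Qed.

Lemma measurable_partial_sum a X N :
  measurable_fun setT (fun w => \sum_(n < N) a n * `|X n w|).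
Proof.
apply: measurable_sum => n; apply: measurable_funM => //.
exact: measurable_abs_RV.
Qed.

Lemma measurable_weighted_sum a X : (forall n, 0 <= a n) ->
  measurable_fun setT (weighted_sum a X).
Proof.
move=> a0; apply: ge0_emeasurable_sum.
  by move=> n w _ _; rewrite lee_fin mulr_ge0.
move=> n _; apply/measurable_EFinP; apply: measurable_funM => //.
exact: measurable_abs_RV.
Qed.

Lemma measurable_weighted_sum_ge a X r : (forall n, 0 <= a n) ->
  measurable [set w | (r%:E <= weighted_sum a X w)%E].
Proof.
move=> a0; rewrite -[X in measurable X]setTI.
by apply: emeasurable_fun_c_infty => //; exact: measurable_weighted_sum.
Qed.

Lemma measure_bigcup_le (A : nat -> set T) (B : \bar R) :
    (forall n, measurable (A n)) -> nondecreasing_seq A ->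
    (forall n, (P (A n) <= B)%E) ->
  (P (\bigcup_n A n) <= B)%E.
Proof.
move=> mA ndA PAB.
have mU : measurable (\bigcup_n A n) by exact: bigcupT_measurable.
have PA := nondecreasing_cvg_mu (mu := P) mA mU ndA.
rewrite -(cvg_lim _ PA)//; apply: lime_le; last exact: nearW.
by apply/cvg_ex; exists (P (\bigcup_n A n)).
Qed.

Lemma mgf_partial_sum a X (t : R) N : independent_seq X ->
    (forall n, (\int[P]_w (expR (t * a n * `|X n w|))%:E < +oo)%E) ->
  (\int[P]_w (expR (t * \sum_(n < N) a n * `|X n w|))%:E =
   \prod_(n < N) \int[P]_w (expR (t * a n * `|X n w|))%:E)%E.
Proof.
move=> indX fin.
rewrite -(@expectation_prod _ _ _ P X (fun n x => expR (t * a n * `|x|)))//.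
- apply: eq_integral => w _; congr EFin; rewrite mulr_sumr expR_sum.
  by apply: eq_bigr => i _; rewrite mulrA.
- move=> i; apply: measurableT_comp => //; apply: measurable_funM => //.
Qed.

(** Markov's inequality for [exp (t S_N)], whose expectation is a product. *)
Lemma chernoff_partial_sum a X (t r : R) (k : nat -> R) N : 0 <= t ->
    independent_seq X ->
    (forall n, (\int[P]_w (expR (t * a n * `|X n w|))%:E <= (expR (k n))%:E)%E) ->
  (P [set w | (r <= \sum_(n < N) a n * `|X n w|)%R] <=
   (expR (- (t * r) + \sum_(n < N) k n))%:E)%E.
Proof.
move=> t0 indX mgf; set A := [set w | _].
have mS := measurable_partial_sum a X N.
have mA : measurable A by exact: measurable_ge.
suff : ((expR (t * r))%:E * P A <= (expR (\sum_(n < N) k n))%:E)%E.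
  by rewrite addrC expRD expRN EFinM lee_pdivlMr ?expR_gt0// muleC.
apply: (@le_trans _ _ (\int[P]_w (expR (t * \sum_(n < N) a n * `|X n w|))%:E)%E).
  rewrite -[A in P A]setIT -integral_indic// -ge0_integralZl_EFin ?expR_ge0//.
  - apply: ge0_le_integral => //.
    + by apply: measurable_funeM; apply/measurable_EFinP; exact: measurable_indic.
    + exact: measurable_expRM.
    move=> w _; rewrite -EFinM lee_fin indicE.
    case: (boolP (w \in A)) => [/set_mem wA|_]; last by rewrite mulr0 expR_ge0.
    by rewrite mulr1 ler_expR ler_wpM2l.
  - by apply/measurable_EFinP; exact: measurable_indic.
rewrite mgf_partial_sum//; last by move=> n; rewrite (le_lt_trans (mgf n)) ?ltry.
rewrite expR_sum -prodEFin.
apply: lee_prod_ge0 => n _; rewrite mgf andbT.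
by apply: integral_ge0 => w _; rewrite lee_fin expR_ge0.
Qed.

(** If the series is at least [r], some partial sum exceeds [r - 1]; lowering
    the level by one costs the extra term [t] in the exponent, which is
    harmless since [t] is of smaller order than [t * r]. *)
Lemma chernoff_weighted_sum a X (t r K : R) (k : nat -> R) : 0 <= t ->
    (forall n, 0 <= a n) -> independent_seq X ->
    (forall n, (\int[P]_w (expR (t * a n * `|X n w|))%:E <= (expR (k n))%:E)%E) ->
    (forall N, \sum_(n < N) k n <= K) ->
  (P [set w | (r%:E <= weighted_sum a X w)%E] <= (expR (- (t * r) + K + t))%:E)%E.
Proof.
move=> t0 a0 indX mgf kK.
pose A N := [set w | (r - 1 <= \sum_(n < N) a n * `|X n w|)%R].
have mA N : measurable (A N) by apply: measurable_ge; exact: measurable_partial_sum.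
have ndA : nondecreasing_seq A.
  move=> m n mn; apply/subsetPset => w; rewrite /A/= => /le_trans; apply.
  rewrite -(big_mkord xpredT (fun n => a n * `|X n w|)).
  rewrite -[leRHS](big_mkord xpredT (fun n => a n * `|X n w|)).
  rewrite [leRHS](big_cat_nat _ mn)//= lerDl sumr_ge0// => i _.
  by rewrite mulr_ge0.
apply: (@le_trans _ _ (P (\bigcup_N A N))).
  apply: le_measure; rewrite ?inE//; first exact: measurable_weighted_sum_ge.
    exact: bigcupT_measurable.
  move=> w /= rS; apply: contrapT => nA.
  have : (weighted_sum a X w <= (r - 1)%:E)%E.
    apply: lime_le; first by apply: is_cvg_nneseries => n _ _; rewrite lee_fin mulr_ge0.
    apply: nearW => N; rewrite sumEFin lee_fin big_mkord leNgt; apply/negP => lt.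
    by apply: nA; exists N => //; exact: ltW.
  by move=> /(le_trans rS); rewrite lee_fin; lra.
apply: measure_bigcup_le => // N.
apply: le_trans (chernoff_partial_sum _ _ t0 indX mgf) _.
by rewrite lee_fin ler_expR; have := kK N; lra.
Qed.

Lemma expectation_exp_iid X n (t : R) : identically_distributed X ->
  (\int[P]_w (expR (t * `|X n w|))%:E = \int[P]_w (expR (t * `|X 0%N w|))%:E)%E.
Proof.
move=> idX; apply: (@expectation_iid _ _ _ P X (fun x => expR (t * `|x|))) => //.
by apply: measurableT_comp => //; apply: measurable_funM.
Qed.

(** The exponent [- t r + c (p-1) \sum (x n)^p], where [t a_n = c p (x n)^(p-1)],
    is minimal over [t] when [x n = (r / A) (a n / A)^(q-1)]: this is the equality case
    of Hoelder's inequality, [\sum (x n)^p = (r / A)^p] and [t r = c p (r / A)^p]. *)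
Lemma weighted_sum_tail_le_gt1 X a (p q c A V M : R) :
    iid X -> 1 < p -> p^-1 + q^-1 = 1 -> 0 <= c -> 0 < A -> (forall n, 0 < a n) ->
    (forall N, \sum_(n < N) a n `^ q <= A `^ q) ->
    (forall N, \sum_(n < N) a n <= V) ->
    (\int[P]_w (expR (c * `|X 0%N w| `^ p))%:E <= M%:E)%E ->
  exists2 C, 0 <= C & forall r, 0 <= r ->
    (P [set w | (r%:E <= weighted_sum a X w)%E] <=
     (expR (- (c * (r / A) `^ p) + C * (r / A) `^ (p - 1)))%:E)%E.
Proof.
move=> [indX idX] p1 pq c0 A0 a0 aq aV intM.
have a0' n : 0 <= a n by exact: ltW.
have p0 : 0 < p by rewrite (lt_trans _ p1).
have p10 : 0 < p - 1 by rewrite subr_gt0.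
have qE := conjugate_exponentE p1 pq.
have [C C0 mgf] := mgf_powR_bound (measurable_abs_RV X 0) (fun w => normr_ge0 _) p1 c0 intM.
have V0 : 0 <= V by have := aV 0; rewrite big_ord0.
exists (C * V / A + c * p / A) => [|r r0].
  by rewrite addr_ge0// divr_ge0 ?mulr_ge0// ltW.
pose y := r / A.
have y0 : 0 <= y by rewrite divr_ge0// ltW.
pose x n := y * (a n / A) `^ (q - 1).
have aA0 n : 0 <= a n / A by rewrite divr_ge0// ltW.
have xp1 n : x n `^ (p - 1) = y `^ (p - 1) * (a n / A).
  rewrite powRM ?powR_ge0// -powRrM (_ : _ * (p - 1) = 1) ?powRr1//.
  by rewrite qE; field; rewrite gt_eqF.
have xp n : x n `^ p = y `^ p * (a n `^ q / A `^ q).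
  rewrite powRM ?powR_ge0// -powRrM (_ : _ * p = q); last first.
    by rewrite qE; field; rewrite gt_eqF.
  by rewrite powR_div// ltW.
pose t := c * p * y `^ (p - 1) / A.
have t0 : 0 <= t by rewrite /t divr_ge0 ?mulr_ge0 ?powR_ge0// ltW.
pose k n := c * (p - 1) * x n `^ p + C * x n `^ (p - 1).
have kmgf n : (\int[P]_w (expR (t * a n * `|X n w|))%:E <= (expR (k n))%:E)%E.
  rewrite expectation_exp_iid// (_ : t * a n = c * p * x n `^ (p - 1)).
    by apply: mgf; rewrite /x mulr_ge0// powR_ge0.
  by rewrite xp1 /t; ring.
have kK N : \sum_(n < N) k n <= c * (p - 1) * y `^ p + C * (y `^ (p - 1) * (V / A)).
  rewrite big_split/= -!mulr_sumr lerD//.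
    rewrite ler_wpM2l ?mulr_ge0// ?(ltW p10)//.
    under eq_bigr do rewrite xp.
    rewrite -mulr_sumr ler_piMr ?powR_ge0// -mulr_suml.
    by rewrite ler_pdivrMr ?powR_gt0// mul1r; exact: aq.
  rewrite ler_wpM2l//.
  under eq_bigr do rewrite xp1.
  by rewrite -mulr_sumr ler_wpM2l ?powR_ge0// -mulr_suml ler_pM2r ?invr_gt0// aV.
apply: le_trans (chernoff_weighted_sum r t0 a0' indX kmgf kK) _.
rewrite lee_fin ler_expR -/y le_eqVlt; apply/orP; left; apply/eqP.
have tr : t * r = c * p * y `^ p.
  rewrite /t -(mulr_powRB1 y0 p0) /y; field; exact: lt0r_neq0.
rewrite tr /t; field; exact: lt0r_neq0.
Qed.

(** Here the Laplace transform is only controlled up to [c], and [t = c / A]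
    is the largest value for which every [t * a n] stays below it. *)
Lemma weighted_sum_tail_le_1 X a (c A V M : R) :
    iid X -> 0 <= c -> 0 < A -> (forall n, 0 < a n) ->
    (forall n, a n <= A) -> (forall N, \sum_(n < N) a n <= V) ->
    (\int[P]_w (expR (c * `|X 0%N w|))%:E <= M%:E)%E ->
  exists2 C, 0 <= C & forall r,
    (P [set w | (r%:E <= weighted_sum a X w)%E] <= (expR (- (c * (r / A)) + C))%:E)%E.
Proof.
move=> [indX idX] c0 A0 a0 aA aV intM.
have a0' n : 0 <= a n by exact: ltW.
have V0 : 0 <= V by have := aV 0; rewrite big_ord0.
have M1 : 0 <= Num.max 0 (M - 1) by rewrite le_max lexx.
exists (Num.max 0 (M - 1) * (V / A) + c / A) => [|r].
  by rewrite addr_ge0// ?mulr_ge0 ?invr_ge0 ?(ltW A0).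
have t0 : 0 <= c / A by rewrite divr_ge0// ltW.
(* The positive part makes the constant nonnegative without showing [1 <= M]. *)
pose k n := Num.max 0 (M - 1) * (a n / A).
have kmgf n : (\int[P]_w (expR (c / A * a n * `|X n w|))%:E <= (expR (k n))%:E)%E.
  rewrite expectation_exp_iid//.
  have s01 : 0 <= a n / A <= 1 by rewrite divr_ge0 ?(ltW A0)//= ler_pdivrMr// mul1r.
  have mY : measurable_fun setT (fun w => c * `|X 0%N w|).
    by apply: measurable_funM => //; exact: measurable_abs_RV.
  have := mgf_convex mY s01 intM.
  have aAc : a n / A * c = c / A * a n by ring.
  under eq_integral do rewrite mulrA aAc.
  move=> /le_trans; apply; rewrite lee_fin ler_expR /k [leLHS]mulrC.
  have /andP[sn0 _] := s01.
  by rewrite ler_wpM2r// le_max lexx orbT.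
have kK N : \sum_(n < N) k n <= Num.max 0 (M - 1) * (V / A).
  by rewrite -mulr_sumr ler_wpM2l// -mulr_suml ler_pM2r ?invr_gt0// aV.
apply: le_trans (chernoff_weighted_sum r t0 a0' indX kmgf kK) _.
rewrite lee_fin ler_expR le_eqVlt; apply/orP; left; apply/eqP.
field; exact: lt0r_neq0.
Qed.

End Chernoff.

(** * Lower bounds, and summability of the weights *)

Section Lower.
Context {d : measure_display} {T : measurableType d} {R : realType}
        (P : probability T R).
Implicit Types (X : nat -> {RV P >-> R}) (a : nat -> R).

Lemma abs_RV_tail_id X n u : identically_distributed X ->
  P [set w | u <= `|X n w|] = P [set w | u <= `|X 0%N w|].
Proof.
move=> idX; have mB : measurable [set x : R | u <= `|x|].
  by apply: measurable_ge; exact: normr_measurable.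
exact: (idX n _ mB).
Qed.

Lemma partial_sum_le_weighted_sum a X N w : (forall n, 0 <= a n) ->
  ((\sum_(n < N) a n * `|X n w|)%:E <= weighted_sum a X w)%E.
Proof.
move=> a0; rewrite -sumEFin -(big_mkord xpredT (fun n => (a n * `|X n w|)%:E)).
by apply: nneseries_lim_ge => n _ _; rewrite lee_fin mulr_ge0.
Qed.

(** The event contains the intersection of the independent events
    [r * x n <= |X n|].  An index with [x n = 0] imposes no condition. *)
Lemma weighted_sum_tail_ge X a (x : nat -> R) (c p : R) N :
    iid X -> 0 <= c -> 0 < p -> (forall n, 0 <= a n) -> (forall n, 0 <= x n) ->
    1 <= \sum_(n < N) a n * x n ->
    (\forall u \near +oo_R,
      (expR (- (c * u `^ p)))%:E <= P [set w | (u <= `|X 0%N w|)%R])%E ->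
  (\forall r \near +oo_R,
    ((expR (- (c * (\sum_(n < N) x n `^ p) * r `^ p)))%:E <=
     P [set w | r%:E <= weighted_sum a X w])%E).
Proof.
move=> [indX idX] c0 p0 a0 x0 ax tail.
have tails : \forall r \near +oo_R, forall n : 'I_N,
    ((expR (- (c * (r * x n) `^ p)))%:E <= P [set w | (r * x n <= `|X n w|)%R])%E.
  apply: filter_forall => n; have := x0 n; rewrite le_eqVlt => /predU1P[<-|xn0].
    near=> r; rewrite mulr0 powR0 ?gt_eqF// mulr0 oppr0 expR0.
    have P1 : P setT = 1%E by exact: probability_setT.
    rewrite (_ : [set _ | _] = setT) ?P1//.
    by apply/seteqP; split => w //= _.
  have [M [_ Mtail]] := tail.
  near=> r; rewrite abs_RV_tail_id//; apply: Mtail.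
  by rewrite -ltr_pdivrMr//; near: r; apply: nbhs_pinfty_gt; exact: num_real.
near=> r.
have r0 : 0 <= r by near: r; apply: nbhs_pinfty_ge; exact: num_real.
have rtail : forall n : 'I_N,
    ((expR (- (c * (r * x n) `^ p)))%:E <= P [set w | (r * x n <= `|X n w|)%R])%E.
  by near: r; exact: tails.
pose B n := [set y : R | r * x n <= `|y|].
have mB n : measurable (B n) by apply: measurable_ge; exact: normr_measurable.
apply: (@le_trans _ _ (P (\bigcap_(n in `I_N) (X n @^-1` B n)))).
  rewrite independent_bigcap// -mulrA mulr_suml mulr_sumr -sumrN expR_sum -prodEFin.
  apply: lee_prod_ge0 => n _; rewrite lee_fin expR_ge0/= -powRM// (mulrC (x n)).
  exact: rtail.
apply: le_measure; rewrite ?inE.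
- by apply: bigcap_measurableType => n _; exact: measurable_funPTI.
- exact: measurable_weighted_sum_ge.
move=> w /= wB; apply: le_trans (partial_sum_le_weighted_sum _ N _ a0).
rewrite lee_fin (@le_trans _ _ (r * \sum_(n < N) a n * x n))//; first by rewrite ler_peMr.
rewrite mulr_sumr ler_sum// => n _; rewrite mulrCA ler_wpM2l//.
exact: (wB n (ltn_ord n)).
Unshelve. all: by end_near. Qed.

(** Let [dl = P(|X 0| >= 1)].  Since [S] is bounded by some [k] with positive
    probability [e], [E exp (- S_N) >= e * exp (- k)] for all [N].  On the other
    hand [E exp (- a n |X n|) <= 1 - dl * (1 - exp (- a n))], and
    [1 - exp (- a n) >= a n / (1 + B)] because [a n <= B]. *)
Lemma as_convergent_summable X a (B : R) :
    iid X -> (forall n, 0 <= a n <= B) -> (0 < P [set w | (1 <= `|X 0%N w|)%R])%E ->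
    as_convergent a X ->
  exists V, forall N, \sum_(n < N) a n <= V.
Proof.
move=> [indX idX] aB Ppos cvX.
have a0 n : 0 <= a n by have /andP[] := aB n.
have mS := @measurable_weighted_sum _ _ _ P a X a0.
pose F k := [set w | (weighted_sum a X w <= k%:R%:E)%E].
have mF k : measurable (F k).
  by rewrite -[X in measurable X]setTI; exact: emeasurable_fun_infty_c.
have ndF : nondecreasing_seq F.
  move=> m n mn; apply/subsetPset => w; rewrite /F/= => /le_trans; apply.
  by rewrite lee_fin ler_nat.
have [k Fk] : exists k, (0 < P (F k))%E.
  apply: contrapT => nF.
  have F0 k : (P (F k) <= 0)%E by rewrite leNgt; apply/negP => k0; apply: nF; exists k.
  have mU : measurable (\bigcup_k F k) by exact: bigcupT_measurable.
  have PU : P (\bigcup_k F k) = 0%E.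
    by apply/eqP; rewrite eq_le measure_ge0 (measure_bigcup_le _ ndF).
  have : P (~` \bigcup_k F k) = 0%E.
    apply/negligibleP; first exact: measurableC.
    apply: negligibleS cvX => w /= wF wS; apply: wF.
    have wfin : weighted_sum a X w \is a fin_num.
      by rewrite ge0_fin_numE//; apply: nneseries_ge0 => n _ _; rewrite lee_fin mulr_ge0.
    exists (Num.truncn (fine (weighted_sum a X w))).+1 => //=.
    by rewrite /F/= -{1}(fineK wfin) lee_fin ltW// truncnS_gt.
  by rewrite probability_setC// PU sube0 => /eqP; rewrite eqe oner_eq0.
pose e := fine (P (F k)).
have eE : P (F k) = e%:E by rewrite fineK// fin_num_measure.
have e0 : 0 < e by rewrite -lte_fin -eE.
pose D := [set w | 1 <= `|X 0%N w|].
have mD : measurable D by apply: measurable_ge; exact: measurable_abs_RV.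
pose dl := fine (P D).
have dE : P D = dl%:E by rewrite fineK// fin_num_measure.
have d0 : 0 < dl by rewrite -lte_fin -dE.
have B0 : 0 <= B by have /andP[/le_trans h /h] := aB 0.
have mgf n : (\int[P]_w (expR (- 1 * a n * `|X n w|))%:E <=
    (expR (- (dl * (a n / (1 + B)))))%:E)%E.
  rewrite (@expectation_exp_iid _ _ _ P X n (- 1 * a n))//.
  pose s := a n / (1 + B).
  have s0 : 0 <= s by rewrite divr_ge0// addr_ge0.
  have sE : expR (- a n) + s <= 1.
    rewrite -lerBrDr expRN.
    apply: (@le_trans _ _ (1 + a n)^-1).
      rewrite lef_pV2 ?posrE ?expR_gt0 ?expR_ge1Dx//.
      by rewrite ltr_pwDl.
    have an1 : 0 < 1 + a n by rewrite ltr_pwDl.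
    rewrite (_ : (1 + a n)^-1 = 1 - a n / (1 + a n)); last by field; exact: lt0r_neq0.
    have /andP[_ anB] := aB n.
    by rewrite lerD2l lerN2 ler_wpM2l// lef_pV2 ?posrE ?lerD2l// ltr_pwDl.
  have mI : measurable_fun setT (fun w => (s * \1_D w)%:E).
    by apply/measurable_EFinP; apply: measurable_funM => //; exact: measurable_indic.
  have : (\int[P]_w ((expR (- 1 * a n * `|X 0%N w|))%:E + (s * \1_D w)%:E) <= 1)%E.
    have P1 : P setT = 1%E by exact: probability_setT.
    rewrite -P1 -[leRHS]mul1e -(integral_cst _ measurableT).
    apply: ge0_le_integral => //.
    - by move=> w _; rewrite -EFinD lee_fin addr_ge0 ?expR_ge0// mulr_ge0// indicE.
    - by apply: emeasurable_funD => //; apply: measurable_expRM; exact: measurable_abs_RV.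
    move=> w _; rewrite -EFinD lee_fin indicE.
    case: (boolP (w \in D)) => [/set_mem wD|_].
      rewrite mulr1 (le_trans _ sE)// lerD2r ler_expR mulN1r mulNr lerN2.
      by rewrite ler_peMr.
    by rewrite mulr0 addr0 -[leRHS]expR0 ler_expR mulN1r mulNr oppr_le0 mulr_ge0.
  have sI0 w : setT w -> (0 <= (s * \1_D w)%:E)%E by rewrite lee_fin mulr_ge0// indicE.
  have eX0 w : setT w -> (0 <= (expR (- 1 * a n * `|X 0%N w|))%:E)%E.
    by rewrite lee_fin expR_ge0.
  have meX := measurable_expRM (- 1 * a n) (measurable_abs_RV X 0%N).
  rewrite ge0_integralD//.
  have -> : (\int[P]_w (s * \1_D w)%:E)%E = (s * dl)%:E.
    under eq_integral do rewrite EFinM.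
    rewrite ge0_integralZl_EFin//; last by apply/measurable_EFinP; exact: measurable_indic.
    rewrite integral_indic// setIT; exact: (congr1 (fun y => s%:E * y)%E dE).
  rewrite -leeBrDr// => /le_trans; apply.
  by rewrite -EFinB lee_fin (mulrC dl) (le_trans _ (expR_ge1Dx _)).
exists ((k%:R - ln e) * (1 + B) / dl) => N.
have : ((expR (- k%:R))%:E * P (F k) <= (expR (- (dl * ((\sum_(n < N) a n) / (1 + B)))))%:E)%E.
  have int1 n : (\int[P]_w (expR (- 1 * a n * `|X n w|))%:E < +oo)%E.
    by rewrite (le_lt_trans (mgf n)) ?ltry.
  apply: (@le_trans _ _ (\int[P]_w (expR (- 1 * \sum_(n < N) a n * `|X n w|))%:E)%E).
    rewrite -[F k]setIT -integral_indic// -ge0_integralZl_EFin ?expR_ge0//; last first.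
      by apply/measurable_EFinP; exact: measurable_indic.
    apply: ge0_le_integral => //.
    - by apply: measurable_funeM; apply/measurable_EFinP; exact: measurable_indic.
    - by apply: measurable_expRM; exact: measurable_partial_sum.
    move=> w _; rewrite -EFinM lee_fin indicE.
    case: (boolP (w \in F k)) => [/set_mem wF|_]; last by rewrite mulr0 expR_ge0.
    rewrite mulr1 ler_expR mulN1r lerN2 -lee_fin.
    exact: le_trans (partial_sum_le_weighted_sum X N w a0) wF.
  rewrite mgf_partial_sum// mulr_suml mulr_sumr -sumrN expR_sum -prodEFin.
  apply: lee_prod_ge0 => n _; rewrite mgf andbT.
  by apply: integral_ge0 => w _; rewrite lee_fin expR_ge0.
rewrite eE -EFinM lee_fin -ler_ln ?posrE ?mulr_gt0 ?expR_gt0//.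
rewrite lnM ?posrE ?expR_gt0// !expRK => h.
rewrite ler_pdivlMr// mulrC -ler_pdivrMr ?ltr_pwDl// -mulrA.
by move: h; lra.
Qed.

End Lower.

(** * The tail of a single variable *)

Section Tail.
Context {d : measure_display} {T : measurableType d} {R : realType}
        (P : probability T R) (X : {RV P >-> R}) (p c : R).
Context (p0 : 0 < p) (c0 : 0 < c)
  (tail : u `^ (- p) * logP P [set w | u <= `|X w|] @[u --> +oo] --> - c).

Let D u := [set w | u <= `|X w|].

Let mD u : measurable (D u).
Proof. by apply: measurable_ge; exact: measurableT_comp. Qed.

Let PDE u : P (D u) = (fine (P (D u)))%:E.
Proof. by rewrite fineK// fin_num_measure. Qed.

(** As [ln 0 = 0], the tail probability could a priori vanish; it does not,
    since its logarithm is eventually negative. *)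
Lemma expR_le_abs_tail c2 : c < c2 ->
  \forall u \near +oo_R, ((expR (- (c2 * u `^ p)))%:E <= P [set w | (u <= `|X w|)%R])%E.
Proof.
move=> cc2.
have lo := cvgr_gt _ tail _ (_ : - c2 < - c).
have hi := cvgr_lt _ tail _ (_ : - c < 0).
near=> u.
have u0 : 0 < u by near: u; apply: nbhs_pinfty_gt; exact: num_real.
have up : 0 < u `^ p by exact: powR_gt0.
have lo' : - c2 < u `^ (- p) * logP P (D u) by near: u; apply: lo; rewrite ltrN2.
have hi' : u `^ (- p) * logP P (D u) < 0 by near: u; apply: hi; rewrite oppr_lt0.
have L0 : logP P (D u) < 0 by move: hi'; rewrite pmulr_rlt0// powR_gt0.
have Ppos : 0 < fine (P (D u)).
  by rewrite ltNge; apply/negP => P0; move: L0; rewrite /logP ln0// ltxx.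
rewrite -/(D u) PDE lee_fin -[leRHS]lnK ?posrE// ler_expR ltW//.
by move: lo'; rewrite powRN ltr_pdivlMl// mulrN mulrC.
Unshelve. all: by end_near. Qed.

(** The constant [C] makes the right-hand side at least [1] on the bounded range
    of [v] where the asymptotic bound is not yet available. *)
Lemma abs_tail_le_expR c1 : 0 <= c1 < c -> exists C, forall v, 0 <= v ->
  (P [set w | (v <= `|X w| `^ p)%R] <= (C * expR (- (c1 * v)))%:E)%E.
Proof.
move=> /andP[c10 c1c].
have hi := cvgr_lt _ tail _ (_ : - c < - c1).
have [M [_ hM]] : \forall u \near +oo_R, 0 < u /\ u `^ (- p) * logP P (D u) < - c1.
  near=> u; split; near: u; first by apply: nbhs_pinfty_gt; exact: num_real.
  by apply: hi; rewrite ltrN2.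
pose v0 := (`|M| + 1) `^ p.
exists (expR (c1 * v0)) => v vge0.
have [vv0|v0v] := leP v v0.
  apply: (@le_trans _ _ 1%E).
    apply: probability_le1; apply: measurable_ge.
    apply: measurableT_comp (measurable_powR _) _; exact: measurableT_comp.
  by rewrite lee_fin -expRD -[leLHS]expR0 ler_expR subr_ge0 ler_wpM2l.
pose u := v `^ p^-1.
have uv : u `^ p = v by rewrite /u -powRrM mulVf ?powRr1// gt_eqF.
have Mu : M < u.
  apply: (@le_lt_trans _ _ `|M|); first exact: ler_norm.
  apply: (@lt_le_trans _ _ (`|M| + 1)); first by rewrite ltrDl.
  have pp1 : p * p^-1 = 1 by rewrite divff// lt0r_neq0.
  rewrite -[leLHS]powRr1 ?addr_ge0// -[X in _ `^ X]pp1 powRrM.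
  apply: ge0_ler_powR; rewrite ?nnegrE ?powR_ge0 ?invr_ge0 ?(ltW p0)//.
  exact: (ltW v0v).
have [u0 hu] := hM _ Mu.
have -> : [set w | v <= `|X w| `^ p] = D u.
  apply/seteqP; split => w /=; rewrite /D/= -uv => h.
    rewrite leNgt; apply/negP => /(gt0_ltr_powR p0).
    by rewrite !nnegrE => /(_ (normr_ge0 _) (ltW u0)); rewrite ltNge h.
  by apply: ge0_ler_powR => //; rewrite ?nnegrE// ltW.
rewrite PDE lee_fin; apply: (@le_trans _ _ (expR (- (c1 * v)))); last first.
  by rewrite ler_peMl ?expR_ge0// -[leLHS]expR0 ler_expR mulr_ge0// powR_ge0.
have [P0|P0] := leP (fine (P (D u))) 0; first exact: le_trans (expR_ge0 _).
rewrite -[leLHS]lnK ?posrE// ler_expR -uv ltW//.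
have up : 0 < u `^ p by exact: powR_gt0.
by move: hu; rewrite powRN ltr_pdivrMl// mulrN mulrC.
Unshelve. all: by end_near. Qed.

End Tail.

(** * Extremal sequences for the dual norm *)

Section Norms.
Context {R : realType}.
Implicit Types (a : nat -> R) (p q V : R).

Lemma summable_pow_bounded a q : 0 < q -> (forall n, 0 < a n) ->
  summable_pow a q -> exists B, forall n, a n <= B.
Proof.
move=> q0 a0 sum_a; pose S := (\sum_(0 <= n <oo) (a n `^ q)%:E)%E.
have aq0 n : (0 <= (a n `^ q)%:E)%E by rewrite lee_fin powR_ge0.
have Sfin : S \is a fin_num by rewrite ge0_fin_numE//; exact: nneseries_ge0.
exists (fine S `^ q^-1) => n.
have aS : a n `^ q <= fine S.
  rewrite -lee_fin fineK//; apply: le_trans (nneseries_lim_ge n.+1 _) => //.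
  by rewrite big_nat_recr//= leeDr// sume_ge0.
rewrite -[leLHS]powRr1 ?(ltW (a0 n))// -[X in _ `^ X](divff (lt0r_neq0 q0)) powRrM.
apply: ge0_ler_powR => //; rewrite ?nnegrE ?invr_ge0 ?powR_ge0// ?(ltW q0)//.
exact: le_trans (powR_ge0 _ _) aS.
Qed.

(** Summability of [a] implies that of [a^q] for [1 <= q], since
    [a n ^ q <= a n * V^(q-1)]; so the norm is finite and is a supremum of
    partial sums. *)
Lemma lq_norm_powR a q V : 1 <= q -> (forall n, 0 < a n) ->
    (forall N, \sum_(n < N) a n <= V) ->
  let A := lq_norm q%:E a in
  [/\ 0 < A, forall N, \sum_(n < N) a n `^ q <= A `^ q &
      forall B, B < A `^ q -> exists N, B < \sum_(n < N) a n `^ q].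
Proof.
move=> q1 a0 aV /=; have q0 : 0 < q by exact: lt_le_trans q1.
have aq0 n : (0 <= (`|a n| `^ q)%:E)%E by rewrite lee_fin powR_ge0.
have normE n : `|a n| = a n by rewrite gtr0_norm.
rewrite lq_norm_fin//; set S := (\sum_(0 <= n <oo) _)%E.
have aleV n : a n <= V.
  by apply: le_trans (aV n.+1); rewrite big_ord_recr/= lerDr sumr_ge0// => i _; exact: ltW.
have V0 : 0 < V by exact: lt_le_trans (aleV 0).
have partial N : (\sum_(0 <= n < N) (`|a n| `^ q)%:E = (\sum_(n < N) a n `^ q)%:E)%E.
  by rewrite sumEFin big_mkord; congr EFin; apply: eq_bigr => n _; rewrite normE.
have le_S B : (forall N, \sum_(n < N) a n `^ q <= B) -> (S <= B%:E)%E.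
  move=> SB; apply: lime_le; first exact: is_cvg_nneseries.
  by apply: nearW => N; rewrite partial lee_fin.
have S_ge N : ((\sum_(n < N) a n `^ q)%:E <= S)%E.
  by rewrite -partial; exact: nneseries_lim_ge.
have Sfin : S \is a fin_num.
  rewrite ge0_fin_numE; last exact: nneseries_ge0.
  apply: (@le_lt_trans _ _ (V * V `^ (q - 1))%:E); last exact: ltry.
  apply: le_S => N; apply: (@le_trans _ _ (\sum_(n < N) a n * V `^ (q - 1))).
    apply: ler_sum => n _; rewrite -(mulr_powRB1 (ltW (a0 n)) q0) ler_pM2l//.
    by apply: ge0_ler_powR => //; rewrite ?subr_ge0 ?nnegrE ?(ltW V0)// ltW.
  by rewrite -mulr_suml ler_pM2r ?powR_gt0.
rewrite -(fineK Sfin) poweR_EFin /=.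
have Sge0 : 0 <= fine S by apply: fine_ge0; exact: nneseries_ge0.
have Sgt0 : 0 < fine S.
  rewrite -lte_fin fineK//; apply: lt_le_trans (S_ge 1).
  by rewrite lte_fin big_ord_recr big_ord0/= add0r powR_gt0.
rewrite -powRrM mulVf ?lt0r_neq0// powRr1//; split.
- exact: powR_gt0.
- by move=> N; rewrite -lee_fin fineK//; exact: S_ge.
- move=> B BS; apply: contrapT => nB.
  have /le_S : forall N, \sum_(n < N) a n `^ q <= B.
    by move=> N; rewrite leNgt; apply/negP => h; apply: nB; exists N.
  by rewrite -(fineK Sfin) lee_fin leNgt BS.
Qed.

Lemma lq_norm_sup a V : (forall n, 0 < a n) -> (forall n, a n <= V) ->
  let A := lq_norm +oo%E a in
  [/\ 0 < A, forall n, a n <= A & forall B, B < A -> exists n, B < a n].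
Proof.
move=> a0 aV /=; rewrite lq_norm_inf; set S := ereal_sup _.
have normE n : `|a n| = a n by rewrite gtr0_norm.
have S_ge n : ((a n)%:E <= S)%E by apply: ereal_sup_ubound; exists n; rewrite ?normE.
have S_le B : (forall n, a n <= B) -> (S <= B%:E)%E.
  by move=> aB; apply: ge_ereal_sup => _ [n _ <-]; rewrite lee_fin normE.
have Sfin : S \is a fin_num.
  rewrite fin_numElt (lt_le_trans _ (S_ge 0%N)) ?ltNyr//=.
  by rewrite (le_lt_trans (S_le V aV)) ?ltry.
split.
- by rewrite -lte_fin fineK// (lt_le_trans _ (S_ge 0%N))// lte_fin.
- by move=> n; rewrite -lee_fin fineK//; exact: S_ge.
- move=> B BS; apply: contrapT => nB.
  have /S_le : forall n, a n <= B.
    by move=> n; rewrite leNgt; apply/negP => h; apply: nB; exists n.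
  by rewrite -(fineK Sfin) lee_fin leNgt BS.
Qed.

(** The equality case of Hoelder's inequality is [x n] proportional to
    [(a n)^(q-1)]; truncating it at [N] costs an arbitrarily small part of [A]. *)
Lemma dual_sequence_gt1 a p q A : 1 < p -> p^-1 + q^-1 = 1 ->
    (forall n, 0 < a n) -> 0 < A ->
    (forall N, \sum_(n < N) a n `^ q <= A `^ q) ->
    (forall B, B < A `^ q -> exists N, B < \sum_(n < N) a n `^ q) ->
  forall A', 0 < A' < A -> exists N (x : nat -> R), [/\ forall n, 0 <= x n,
    1 <= \sum_(n < N) a n * x n & \sum_(n < N) x n `^ p <= A' `^ (- p)].
Proof.
move=> p1 pq a0 A0 aA supA A' /andP[A'0 A'A].
have p0 : 0 < p by rewrite (lt_trans _ p1).
have qE := conjugate_exponentE p1 pq.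
have q0 : 0 < q by rewrite qE divr_gt0// subr_gt0.
have Aq : 0 < A `^ q by exact: powR_gt0.
have [|N AN] := supA (A' / A * A `^ q).
  by rewrite gtr_pMl// ltr_pdivrMr// mul1r.
have quot n r : (a n / A) `^ r = a n `^ r / A `^ r.
  by rewrite powR_div// ltW.
exists N, (fun n => (a n / A) `^ (q - 1) / A'); split.
- by move=> n; rewrite divr_ge0 ?powR_ge0// ltW.
- rewrite (eq_bigr (fun n : 'I_N => a n `^ q * (A / A `^ q / A'))); last first.
    move=> n _; rewrite quot mulrA mulrA mulr_powRB1 ?(ltW (a0 n))//.
    rewrite -(mulr_powRB1 (ltW A0) q0); field.
    by rewrite !lt0r_neq0 ?powR_gt0.
  rewrite -mulr_suml -ler_pdivrMr ?divr_gt0// mul1r.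
  apply: ltW; apply: le_lt_trans AN; rewrite le_eqVlt; apply/orP; left; apply/eqP.
  by field; rewrite !lt0r_neq0.
- rewrite (eq_bigr (fun n : 'I_N => a n `^ q * (A' `^ (- p) / A `^ q))); last first.
    move=> n _; rewrite powR_div ?powR_ge0// -powRrM.
    rewrite (_ : (q - 1) * p = q); last first.
      by rewrite qE; field; rewrite lt0r_neq0// subr_gt0.
    by rewrite quot powRN; ring.
  rewrite -mulr_suml mulrCA ler_piMr ?powR_ge0// ler_pdivrMr// mul1r.
  exact: aA.
Qed.

(** All the mass is put on one index [m] where [a m] nearly attains the
    supremum. *)
Lemma dual_sequence_1 a A : (forall n, 0 < a n) ->
    (forall B, B < A -> exists n, B < a n) ->
  forall A', 0 < A' < A -> exists N (x : nat -> R), [/\ forall n, 0 <= x n,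
    1 <= \sum_(n < N) a n * x n & \sum_(n < N) x n `^ 1 <= A' `^ (- 1)].
Proof.
move=> a0 supA A' /andP[A'0 /supA[m Am]].
exists m.+1, (fun n => if n == m then (a m)^-1 else 0).
have ord_neq (i : 'I_m) : (i : nat) == m = false by rewrite ltn_eqF.
split.
- by move=> n; case: ifP => // _; rewrite invr_ge0 ltW.
- rewrite big_ord_recr/= eqxx divff ?lt0r_neq0// lerDr sumr_ge0// => i _.
  by rewrite ord_neq mulr0.
- rewrite big_ord_recr/= eqxx big1 ?add0r; last by move=> i _; rewrite ord_neq powR0.
  rewrite powRr1 ?invr_ge0 ?(ltW (a0 m))// powR_inv1 ?(ltW A'0)//.
  by rewrite lef_pV2 ?posrE// ltW.
Qed.

End Norms.

(** * The rate of decay of the tail *)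

Section Rate.
Context {d : measure_display} {T : measurableType d} {R : realType}
        (P : probability T R) (X : nat -> {RV P >-> R}).

(** The two bounds give [limsup <= - c' A^-p] for [c' < c] and
    [liminf >= - c'' A'^-p] for [c < c''] and [A' < A]; the parameters are
    chosen so that these values are within [e] of the limit. *)
Lemma log_tail_rate (a : nat -> R) (p c A : R) :
    iid X -> 1 <= p -> 0 < c -> 0 < A -> (forall n, 0 < a n) ->
    u `^ (- p) * logP P [set w | u <= `|X 0%N w|] @[u --> +oo] --> - c ->
    (forall A', 0 < A' < A -> exists N (x : nat -> R), [/\ forall n, 0 <= x n,
       1 <= \sum_(n < N) a n * x n & \sum_(n < N) x n `^ p <= A' `^ (- p)]) ->
    (forall c', 0 < c' < c -> exists2 C, 0 <= C & forall r, 0 <= r ->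
      (P [set w | (r%:E <= weighted_sum a X w)%E] <=
       (expR (- (c' * (r / A) `^ p) + C * (r / A) `^ (p - 1)))%:E)%E) ->
  log_tail a X r / r `^ p @[r --> +oo] --> - (c * A `^ (- p)).
Proof.
move=> iidX p1 c0 A0 a0 tail dual upper.
have p0 : 0 < p by exact: lt_le_trans p1.
have a0' n : 0 <= a n by exact: ltW.
pose L := c * A `^ (- p).
have Ap0 : 0 < A `^ (- p) by exact: powR_gt0.
have L0 : 0 < L by rewrite mulr_gt0.
pose S r := [set w | (r%:E <= weighted_sum a X w)%E].
have PSE r : P (S r) = (fine (P (S r)))%:E.
  by rewrite fineK// fin_num_measure//; exact: measurable_weighted_sum_ge.
apply/cvgrPdist_le => e e0.
(* With [A' = A * l] and [c'' = c / l], this [l] makes [c'' * A'^-p = L + e]. *)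
pose l := (1 + e / L) `^ (- (1 + p)^-1).
have eL0 : 0 < 1 + e / L by rewrite addr_gt0// divr_gt0.
have p10 : 0 < 1 + p by rewrite addr_gt0.
have l0 : 0 < l by exact: powR_gt0.
have l1 : l < 1.
  rewrite /l powRN invf_lt1 ?powR_gt0//.
  have : 1 `^ (1 + p)^-1 < (1 + e / L) `^ (1 + p)^-1.
    apply: gt0_ltr_powR; rewrite ?nnegrE ?invr_gt0//; first exact: ltW.
    by rewrite ltrDl divr_gt0.
  by rewrite powR1.
have lE : l `^ (- p) = l * (1 + e / L).
  rewrite (_ : 1 + e / L = l `^ (- (1 + p))); last first.
    rewrite /l -powRrM mulrNN mulVf ?powRr1 ?ltW//; exact: lt0r_neq0.
  rewrite -{2}(powRr1 (ltW l0)) -powRD; last by apply/implyP => _; exact: lt0r_neq0.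
  by congr powR; ring.
have lA : 0 < A * l < A by rewrite mulr_gt0//= gtr_pMr.
have [N [x [x0 ax xp]]] := dual _ lA.
have cl : c < c / l by rewrite ltr_pdivlMr// gtr_pMr.
have lower := weighted_sum_tail_ge iidX (ltW (lt_trans c0 cl)) p0 a0' x0 ax
  (expR_le_abs_tail c0 tail cl).
(* The error is split: [e / 2] for [c'] and [e / 2] for the term of order [r^(p-1)]. *)
pose c' := Num.max (c / 2) (c - e / 2 / A `^ (- p)).
have c'0 : 0 < c' by rewrite lt_max divr_gt0.
have c'c : c' < c.
  by rewrite gt_max ltr_pdivrMr// ltr_pMr ?ltr1n//= gtrBl !divr_gt0.
have c'L : L - e / 2 <= c' * A `^ (- p).
  have : c - e / 2 / A `^ (- p) <= c' by rewrite le_max lexx orbT.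
  move=> /(ler_wpM2r (ltW Ap0)); apply: le_trans.
  by rewrite mulrBl divfK// lt0r_neq0.
have [|C C0 upC] := upper c'; first by rewrite c'0.
pose C2 := C * A `^ (- (p - 1)).
near=> r.
have r0 : 0 < r by near: r; apply: nbhs_pinfty_gt; exact: num_real.
have rC : C2 / (e / 2) <= r by near: r; apply: nbhs_pinfty_ge; exact: num_real.
have rp : 0 < r `^ p by exact: powR_gt0.
have low : ((expR (- (c / l * (\sum_(n < N) x n `^ p) * r `^ p)))%:E <= P (S r))%E.
  by near: r; exact: lower.
have Ppos : 0 < fine (P (S r)).
  by move: low; rewrite PSE lee_fin; apply: lt_le_trans; exact: expR_gt0.
have logle : - (L + e) * r `^ p <= log_tail a X r.
  rewrite /log_tail /logP -/(S r) -[leLHS]expRK ler_ln ?posrE ?expR_gt0//.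
  move: low; rewrite PSE lee_fin; apply: le_trans.
  rewrite ler_expR mulNr lerN2 ler_pM2r//.
  apply: (@le_trans _ _ (c / l * (A * l) `^ (- p))).
    by rewrite ler_wpM2l// divr_ge0// ltW.
  rewrite powRM ?(ltW A0) ?(ltW l0)// lE le_eqVlt; apply/orP; left; apply/eqP.
  by rewrite /L; field; rewrite !lt0r_neq0.
have logge : log_tail a X r <= - (L - e) * r `^ p.
  have := upC r (ltW r0); rewrite -/(S r) PSE lee_fin => up.
  rewrite /log_tail /logP -/(S r) -[leRHS]expRK ler_ln ?posrE ?expR_gt0//.
  apply: le_trans up _; rewrite ler_expR.
  rewrite !powR_div ?(ltW r0)// -!powRN.
  have h1 : (L - e / 2) * r `^ p <= c' * (r `^ p * A `^ (- p)).
    by rewrite (mulrC (r `^ p)) mulrA ler_pM2r.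
  have h2 : C * (r `^ (p - 1) * A `^ (- (p - 1))) <= e / 2 * r `^ p.
    rewrite -(mulr_powRB1 (ltW r0) p0) (mulrC (r `^ _)) mulrA mulrA -/C2.
    rewrite ler_pM2r ?powR_gt0//.
    by rewrite mulrC -ler_pdivrMr// divr_gt0.
  rewrite (_ : - (L - e) * r `^ p = - ((L - e / 2) * r `^ p) + e / 2 * r `^ p).
    by apply: lerD => //; rewrite lerN2.
  by field.
rewrite -/L ler_norml; apply/andP; split.
  by rewrite lerBrDl -lerBrDr ler_pdivrMr//; move: logge; congr (_ <= _ * _); ring.
by rewrite lerBlDr -lerBlDl ler_pdivlMr//; move: logle; congr (_ * _ <= _); ring.
Unshelve. all: by end_near. Qed.

End Rate.

(** The convention [(-oo)^-1 = -oo] rules out [q = -oo] when [p = 1]. *)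
Lemma conjugate_exponents {R : realType} (p : R) (q : \bar R) : 1 <= p ->
    ((p%:E)^-1 + q^-1 = 1)%E ->
  p = 1 /\ q = +oo%E \/
  1 < p /\ exists2 s, 1 < s & q = s%:E /\ p^-1 + s^-1 = 1.
Proof.
move=> p1; have p0 : 0 < p by exact: lt_le_trans p1.
rewrite inver gt_eqF//; case: q => [s| |].
- rewrite inver; case: eqP => [//|s0]; rewrite -EFinD => -[ps].
  have pI : p^-1 < 1.
    rewrite lt_neqAle invf_le1// p1 andbT; apply/eqP => pI.
    by move: ps; rewrite pI -[RHS]addr0 => /addrI/eqP; rewrite invr_eq0 => /eqP.
  have sI : 0 < s^-1 < 1.
    have -> : s^-1 = 1 - p^-1 by rewrite -ps addrC addKr.
    by rewrite subr_gt0 pI/= gtrBl invr_gt0.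
  right; split; first by rewrite -(invf_lt1 p0).
  exists s => //; case/andP: sI; rewrite invr_gt0 => sgt0.
  by rewrite invf_lt1.
- rewrite invey adde0 => -[pI]; left; split=> //.
  by rewrite -(invrK p) pI invr1.
- by rewrite inveNy.
Qed.

Lemma cvg_pinfty_scale {R : realType} (f : R -> R) (C l : R) : 0 < C ->
  f r @[r --> +oo] --> l -> f (r * C) @[r --> +oo] --> l.
Proof.
move=> C0 fl; apply: cvg_comp fl.
apply/cvgryPge => M; near=> r; rewrite -ler_pdivrMr//.
Unshelve. all: by end_near. Qed.

Section MainRate.
Context {d : measure_display} {T : measurableType d} {R : realType}
        (P : probability T R) (xi : nat -> {RV P >-> R}).

(** A tail probability is positive far out, hence also at [1]. *)
Lemma abs_tail_gt0 (X : {RV P >-> R}) (p c : R) : 0 < c ->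
    u `^ (- p) * logP P [set w | u <= `|X w|] @[u --> +oo] --> - c ->
  (0 < P [set w | (1 <= `|X w|)%R])%E.
Proof.
move=> c0 tail.
have c1 : c < c + 1 by rewrite ltrDl.
have [M [_ hM]] := expR_le_abs_tail c0 tail c1.
pose u := Num.max (M + 1) 1.
have Mu : M < u by rewrite lt_max ltrDl ltr01.
apply: (@lt_le_trans _ _ (P [set w | (u <= `|X w|)%R])).
  by apply: lt_le_trans (hM _ Mu); rewrite lte_fin expR_gt0.
have mX : measurable_fun setT (fun w => `|X w|) by exact: measurableT_comp.
apply: le_measure; rewrite ?inE; [exact: measurable_ge|exact: measurable_ge|].
by move=> w /=; apply: le_trans; rewrite le_max lexx orbT.
Qed.

(** Almost sure convergence makes [\sum a n] finite, whatever [p].  The cases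
    [p = 1] and [1 < p] then differ only in how the dual norm is approached and
    in the range of [t] where [E exp (t |xi|)] is finite. *)
Theorem log_tail_asymptotics (p c : R) (q : \bar R) (a : nat -> R) :
    iid xi -> 1 <= p -> 0 < c ->
    u `^ (- p) * logP P [set w | u <= `|xi 0%N w|] @[u --> +oo] --> - c ->
    ((p%:E)^-1 + q^-1 = 1)%E -> (forall n, 0 < a n) ->
    summable_pow a (two_min q) -> as_convergent a xi ->
  0 < lq_norm q a /\
  log_tail a xi r / r `^ p @[r --> +oo] --> - (c * lq_norm q a `^ (- p)).
Proof.
move=> xi_iid p1 c0 tail pq a0 a_sum a_cvg.
have p0 : 0 < p by exact: lt_le_trans p1.
have a0' n : 0 <= a n by exact: ltW.
have cases := conjugate_exponents p1 pq.
have two_min_gt0 : 0 < two_min q.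
  case: cases => [[_ ->]|[_ [s s1 [-> _]]]]; rewrite /two_min ?miney//=.
  by rewrite -EFin_min/= lt_min ltr0n (lt_trans _ s1).
have [B aB] := summable_pow_bounded two_min_gt0 a0 a_sum.
have aB' n : 0 <= a n <= B by rewrite a0' aB.
have [V aV] := as_convergent_summable xi_iid aB' (abs_tail_gt0 c0 tail) a_cvg.
have moment c' : 0 < c' < c ->
    exists M, (\int[P]_w (expR (c' * `|xi 0%N w| `^ p))%:E <= M%:E)%E.
  move=> /andP[c'0 c'c]; pose c1 := (c' + c) / 2.
  have c'1 : c' < c1 < c by rewrite midf_lt// midf_lt.
  have /andP[c'c1 c1c] := c'1.
  have [|C tailC] := abs_tail_le_expR p0 tail (_ : 0 <= c1 < c).
    by rewrite (le_trans (ltW c'0) (ltW c'c1)).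
  have mY : measurable_fun setT (fun w => `|xi 0%N w| `^ p).
    exact: measurableT_comp (measurable_powR _) (measurable_abs_RV _ _).
  have c'c1' : 0 <= c' < c1 by rewrite (ltW c'0).
  have int_lt := exp_moment_finite mY (fun w => powR_ge0 _ _) c'c1' tailC.
  exists (fine (\int[P]_w (expR (c' * `|xi 0%N w| `^ p))%:E)%E).
  rewrite fineK// ge0_fin_numE//.
  by apply: integral_ge0 => w _; rewrite lee_fin expR_ge0.
case: cases => [[p1E qE]|[pgt1 [s s1 [-> ps]]]].
  have aV1 n : a n <= V.
    by apply: le_trans (aV n.+1); rewrite big_ord_recr/= lerDr sumr_ge0.
  rewrite qE; have [A0 aA supA] := lq_norm_sup a0 aV1.
  split=> //; apply: (log_tail_rate xi_iid p1 c0 A0 a0 tail).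
    by rewrite p1E; exact: dual_sequence_1.
  move=> c' c'c; have [M intM] := moment _ c'c.
  have /andP[c'0 _] := c'c.
  have intM1 : (\int[P]_w (expR (c' * `|xi 0%N w|))%:E <= M%:E)%E.
    by move: intM; rewrite p1E; under eq_integral do rewrite powRr1//.
  have [C C0 hC] := weighted_sum_tail_le_1 xi_iid (ltW c'0) A0 a0 aA aV intM1.
  exists C => // r r0; rewrite p1E powRr1 ?divr_ge0 ?(ltW A0)// subrr powRr0 mulr1.
  exact: hC.
have [A0 aA supA] := lq_norm_powR (ltW s1) a0 aV.
split=> //; apply: (log_tail_rate xi_iid p1 c0 A0 a0 tail).
  exact: (dual_sequence_gt1 pgt1 ps a0 A0 aA supA).
move=> c' c'c; have [M intM] := moment _ c'c.
have /andP[c'0 _] := c'c.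
exact: (weighted_sum_tail_le_gt1 xi_iid pgt1 ps (ltW c'0) A0 a0 aA aV intM).
Qed.

End MainRate.

Unset Implicit Arguments.

Theorem corollary3p2 (d : measure_display) (T : measurableType d)
    (R : realType) (P : probability T R) (xi : nat -> {RV P >-> R})
    (p c : R) (q : \bar R) (a b : nat -> R)
    (xi_iid : iid xi)
    (xi_int : ('E_P[(fun w => `|xi 0%N w|)%R] < +oo)%E)
    (p_ge1 : 1 <= p) (c_gt0 : 0 < c)
    (xi_tail : u `^ (- p) * logP P [set w | u <= `|xi 0%N w|]
               @[u --> +oo] --> - c)
    (pq : ((p%:E)^-1 + q^-1 = 1)%E)
    (a_gt0 : forall n, 0 < a n) (b_gt0 : forall n, 0 < b n)
    (a_sum : summable_pow a (two_min q))
    (b_sum : summable_pow b (two_min q))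
    (a_cvg : as_convergent a xi) (b_cvg : as_convergent b xi) :
  asymp_equiv (fun r => log_tail a xi r / log_tail b xi r)
              (fun _ => (lq_norm q b / lq_norm q a) `^ p)
  /\
  asymp_equiv (fun r => log_tail a xi (r * lq_norm q a) /
                        log_tail b xi (r * lq_norm q b))
              (fun _ => 1).
Proof.
have [A0 rate_a] := log_tail_asymptotics xi_iid p_ge1 c_gt0 xi_tail pq a_gt0 a_sum a_cvg.
have [B0 rate_b] := log_tail_asymptotics xi_iid p_ge1 c_gt0 xi_tail pq b_gt0 b_sum b_cvg.
move: rate_a rate_b A0 B0; set A := lq_norm q a; set B := lq_norm q b => rate_a rate_b A0 B0.
have rate_neq0 (C : R) : 0 < C -> - (c * C `^ (- p)) != 0.
  by move=> C0; rewrite oppr_eq0 mulf_neq0 ?lt0r_neq0 ?powR_gt0.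
split.
  rewrite /asymp_equiv.
  have lim : (log_tail a xi r / r `^ p) / (log_tail b xi r / r `^ p) / (B / A) `^ p
      @[r --> +oo] --> - (c * A `^ (- p)) / - (c * B `^ (- p)) / (B / A) `^ p.
    by apply: cvgMr_tmp; apply: cvgM rate_a _; apply: cvgV rate_b; exact: rate_neq0.
  have limE : - (c * A `^ (- p)) / - (c * B `^ (- p)) / (B / A) `^ p = 1.
    rewrite powR_div ?(ltW B0)// !powRN; field.
    by rewrite !lt0r_neq0 ?powR_gt0.
  rewrite limE in lim; apply: cvg_trans lim; apply: near_eq_cvg.
  near=> r.
  have r0 : 0 < r by near: r; apply: nbhs_pinfty_gt; exact: num_real.
  congr (_ / _); rewrite invf_div mulrA divfK//.
  by rewrite lt0r_neq0 ?powR_gt0.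
rewrite /asymp_equiv.
have lim : (log_tail a xi (r * A) / (r * A) `^ p) / (log_tail b xi (r * B) / (r * B) `^ p)
      * (A `^ p / B `^ p)
      @[r --> +oo] --> - (c * A `^ (- p)) / - (c * B `^ (- p)) * (A `^ p / B `^ p).
  apply: cvgMr_tmp; apply: cvgM (cvg_pinfty_scale A0 rate_a) _.
  by apply: cvgV (cvg_pinfty_scale B0 rate_b); exact: rate_neq0.
(* The scaled limits differ by the factor that [(r * A)^p / (r * B)^p] cancels. *)
have limE : - (c * A `^ (- p)) / - (c * B `^ (- p)) * (A `^ p / B `^ p) = 1.
  by rewrite !powRN; field; rewrite !lt0r_neq0 ?powR_gt0.
rewrite limE in lim; apply: cvg_trans lim; apply: near_eq_cvg.
near=> r.
have r0 : 0 < r by near: r; apply: nbhs_pinfty_gt; exact: num_real.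
rewrite divr1 !powRM ?(ltW r0) ?(ltW A0) ?(ltW B0)//.
have [->|Lb] := eqVneq (log_tail b xi (r * B)) 0; first by rewrite !(mul0r, invr0, mulr0).
by field; rewrite Lb !lt0r_neq0 ?powR_gt0.
Unshelve. all: by end_near. Qed.
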